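(* Let $\mathcal{C}$ be a $d$-dimensional piecewise linear simplicial cycle in $\mathbb{R}^d$. For each $d$-dimensional simplex $\Delta_i\in\mathcal{C}$ let $\mathbf{o}_i$ and $\mathbf{m}_i$ be its circumcenter and its centroid, respectively, and let $\mathrm{Vol}(\Delta_i)$ be its signed volume. Then $$\sum_{\Delta_i\in\mathcal{C}} \mathrm{Vol}(\Delta_i)\,\overrightarrow{\mathbf{o}_i\mathbf{m}_i}=\mathbf{0}.$$
   Context: A $d$-dimensional piecewise linear simplicial chain in $\mathbb{R}^d$ is a finite formal sum (with repetitions allowed) of oriented nondegenerate affine $d$-simplices $\Delta_i=\mathrm{conv}(\mathbf{v}_0,\dots,\mathbf{v}_d)\subset\mathbb{R}^d$; the simplices may overlap. Reversing the orientation of a simplex changes its sign in the chain. It is a cycle if its simplicial boundary, the formal sum of the oriented $(d-1)$-dimensional faces of all its simplices with the usual boundary signs, is zero (oriented faces with the same vertex set and opposite orientations cancel). $\mathrm{Vol}(\Delta_i)$ is the signed volume: the Euclidean volume taken with sign $+$ if the orientation of $\Delta_i$ agrees with the standard orientation of $\mathbb{R}^d$ and $-$ otherwise. The sum over $\Delta_i\in\mathcal{C}$ counts simplices with multiplicity. The circumcenter is the center of the sphere through all vertices; the centroid is the average of the vertices; $\overrightarrow{\mathbf{a}\mathbf{b}}=\mathbf{b}-\mathbf{a}$. *)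

(* Defs.v *)
From mathcomp Require Import all_boot all_order all_algebra all_fingroup.
From mathcomp Require Import all_classical all_reals all_analysis.

Set Implicit Arguments.
Unset Strict Implicit.
Unset Printing Implicit Defensive.

Import Order.TTheory GRing.Theory Num.Theory.
Import numFieldNormedType.Exports.

Local Open Scope classical_set_scope.
Local Open Scope ring_scope.

(* Points of R^d are row vectors; a (d+1)-tuple of points is the matrix whose
   i-th row is the i-th point. *)

(** * Volume *)

(* The n-fold product of the one-dimensional Lebesgue measure; R^0 is a point
   of mass 1. *)
Fixpoint lebesgue_tuple (R : realType) (n : nat) :
    set (n.-tuple (measurableTypeR R)) -> \bar R :=
  match n with
  | 0%N => (\d_([tuple] : 0.-tuple (measurableTypeR R)))%E
  | n'.+1 =>
    pushforward (@lebesgue_measure R \x @lebesgue_tuple R n')%E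
      (fun p => [tuple of p.1 :: p.2])
  end.

Definition volume (R : realType) (d : nat) (A : set 'rV[R]_d) : R :=
  fine (@lebesgue_tuple R d [set t | A (\row_j tnth t j)]).

Definition conv (R : realType) (m d : nat) (V : 'M[R]_(m, d)) : set 'rV[R]_d :=
  [set x | exists w : 'I_m -> R,
    [/\ forall i, 0 <= w i, \sum_i w i = 1 & x = \sum_i w i *: row i V]].

(** * Oriented simplices *)

Definition edge_mx (R : realType) (d : nat) (V : 'M[R]_(d.+1, d)) : 'M[R]_d :=
  \matrix_(i < d) (row (lift ord0 i) V - row ord0 V).

(* An oriented simplex is given by an ordering of its vertices: orderings that
   differ by an even permutation stand for the same oriented simplex, and an
   odd permutation reverses the orientation. *)
Record simplex (R : realType) (d : nat) := Simplex {
  vertices :> 'M[R]_(d.+1, d);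
  nondegenerate : row_free (edge_mx vertices)
}.

Definition orientation (R : realType) (d : nat) (D : simplex R d) : R :=
  Num.sg (\det (edge_mx D)).

Definition signed_volume (R : realType) (d : nat) (D : simplex R d) : R :=
  orientation D * volume (conv D).

Definition centroid (R : realType) (d : nat) (D : simplex R d) : 'rV[R]_d :=
  d.+1%:R^-1 *: \sum_i row i D.

(* The norm of the library on row vectors is the sup norm. *)
Definition euclidean_dist (R : realType) (d : nat) (x y : 'rV[R]_d) : R :=
  Num.sqrt (\sum_j (x 0 j - y 0 j) ^+ 2).

Definition is_circumcenter (R : realType) (d : nat) (D : simplex R d)
    (o : 'rV[R]_d) : Prop :=
  exists r : R, forall i, euclidean_dist o (row i D) = r.

Definition circumcenter (R : realType) (d : nat) (D : simplex R d) : 'rV[R]_d :=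
  xget 0 [set o | is_circumcenter D o].

(** * Chains and cycles *)

(* The entries of the list are the terms of the formal sum; for 0 < d,
   the term -D is D with two vertices exchanged. *)
Definition chain (R : realType) (d : nat) := seq (simplex R d).

(* For f with distinct rows: 1 if f and g are the same oriented face, -1 if
   they are opposite oriented faces, 0 if their vertex sets differ. *)
Definition face_coef (R : realType) (d : nat) (f g : 'M[R]_d) : int :=
  \sum_(s : 'S_d | row_perm s f == g) (-1) ^+ s.

Definition boundary (R : realType) (d : nat) (C : chain R d) (g : 'M[R]_d) :
    int :=
  \sum_(D <- C) \sum_(i < d.+1) (-1) ^+ i * face_coef (row' i D) g.

Definition is_cycle (R : realType) (d : nat) (C : chain R d) : Prop :=
  forall g : 'M[R]_d, boundary C g = 0.

(* Main.v *)
Require Import Defs.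
From HB Require Import structures.
From mathcomp Require Import all_boot all_order all_algebra all_fingroup.
From mathcomp Require Import all_classical all_reals all_analysis.
From mathcomp Require Import measurable_realfun ring.

Set Implicit Arguments.
Unset Strict Implicit.
Unset Printing Implicit Defensive.

Import Order.TTheory GRing.Theory Num.Theory.
Local Open Scope ring_scope.
Local Open Scope classical_set_scope.

(* The vector det(edges of D) * (centroid - circumcenter) is the alternating sum
   over the faces of D of an alternating function of the face, and such a sum
   vanishes on cycles. For the k-th coordinate of the circumcenter, Cramer's
   rule gives half the determinant of the edge matrix with column k replaced by
   the differences of the squared norms of the vertices; for the centroid, the
   face function is, up to a scalar, the moment of the cone from the origin over
   the face.

   The signed volume is a constant multiple of det(edges of D), because affine
   maps scale Lebesgue measure by the absolute value of their determinant: up to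
   a shear, an invertible affine map is the composite of a map that changes only
   the first coordinate and one that preserves it, so Fubini's theorem, slicing
   in either order, reduces the claim to dimensions 1 and d - 1. The value 1/d!
   of the constant does not matter. *)

(** * Lebesgue measure of affine preimages *)

(* The library's sigma-finite structure on product measures is hidden by the
   later instance for subprobabilities. *)
Lemma sigma_finite_product_measure1 d1 d2 (T1 : measurableType d1)
    (T2 : measurableType d2) (R : realType)
    (m1 : {sigma_finite_measure set T1 -> \bar R})
    (m2 : {sigma_finite_measure set T2 -> \bar R}) :
  sigma_finite setT (m1 \x m2)%E.
Proof.
have /sigma_finiteP[F [TF ndF Foo]] := sigma_finiteT m1.
have /sigma_finiteP[G [TG ndG Goo]] := sigma_finiteT m2.
exists (fun n => F n `*` G n).
  apply/seteqP; split=> -[x y]//= _.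
  have [n _ Fnx] : (\bigcup_i F i) x by rewrite -TF.
  have [k _ Gky] : (\bigcup_i G i) y by rewrite -TG.
  exists (maxn n k) => //; split.
    by move: x Fnx; exact/subsetPset/ndF/leq_maxl.
  by move: y Gky; exact/subsetPset/ndG/leq_maxr.
move=> k; have [mF Fk] := Foo k; have [mG Gk] := Goo k.
split; first exact: measurableX.
by rewrite product_measure1E// lte_mul_pinfty// ge0_fin_numE.
Qed.

(* The canonical measure structure on [pushforward m f] needs a proof that f is
   measurable, which unification cannot find. *)
Local Notation pushforward_measure :=
  measure_function_pushforward__canonical__measure_function_Measure.

Lemma sigma_finite_pushforward d1 d2 (T1 : measurableType d1)
    (T2 : measurableType d2) (R : realType)
    (m : {measure set T1 -> \bar R}) (f : T1 -> T2) (g : T2 -> T1) :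
  sigma_finite setT m ->
  measurable_fun setT f -> measurable_fun setT g -> cancel f g ->
  exists p : {sigma_finite_measure set T2 -> \bar R}, pushforward m f = p.
Proof.
move=> [F TF Foo] mf mg fK.
pose p : {measure set T2 -> \bar R} :=
  pushforward_measure m mf.
have ps : sigma_finite setT p.
  exists (fun k => g @^-1` F k); first by rewrite -preimage_bigcup -TF.
  move=> k; have [mF Fk] := Foo k; split.
    by rewrite -[X in measurable X]setTI; exact: mg.
  by rewrite /p/= /pushforward -comp_preimage (_ : g \o f = id)//; apply/funext.
pose s := Measure_isSigmaFinite.Build _ _ _ p ps.
by exists (HB.pack_for (sigma_finite_measure T2 R) (p : set T2 -> \bar R) s p).
Qed.

Lemma lebesgue_tuple_sigma_finite (R : realType) n :
  exists m : {sigma_finite_measure set (n.-tuple (measurableTypeR R)) -> \bar R},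
    @lebesgue_tuple R n = m.
Proof.
elim: n => [|n [m mE]].
  by exists (\d_([tuple] : 0.-tuple (measurableTypeR R)))%E.
rewrite /= mE.
apply: (sigma_finite_pushforward (m := (lebesgue_measure \x m)%E)
  (g := fun t => (thead t, [tuple of behead t]))).
- exact: sigma_finite_product_measure1.
- exact: measurable_cons.
- by apply: measurable_fun_pair;
    [exact: measurable_tnth | exact: measurable_behead].
- by case=> x t; congr pair; exact: val_inj.
Qed.

(** For a positive slope [c], [c] times the pushforward agrees with Lebesgue measure on half-open
    intervals, hence everywhere by uniqueness. A negative slope reduces to this by reflection
    invariance. *)
Lemma lebesgue_measure_affine (R : realType) (a b : R)
    (A : set (measurableTypeR R)) : a != 0 -> measurable A ->
  lebesgue_measure [set x : measurableTypeR R | A (a * x + b)] =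
    (`|a|^-1%:E * lebesgue_measure A)%E.
Proof.
have pos (c e : R) (B : set (measurableTypeR R)) : 0 < c -> measurable B ->
  lebesgue_measure [set x : measurableTypeR R | B (c * x + e)] =
    (c^-1%:E * lebesgue_measure B)%E.
  move=> c0 mB.
  pose f (x : measurableTypeR R) : measurableTypeR R := c * x + e.
  have mf : measurable_fun setT f.
    by apply: measurable_funD => //; exact: mulrl_measurable.
  pose k := NngNum (ltW c0).
  pose p : {measure set _ -> \bar R} :=
    mscale k (pushforward_measure lebesgue_measure mf).
  rewrite (lebesgue_measure_unique (mu := p) _ mB).
    by rewrite /p/= /mscale/= /pushforward muleA -EFinM mulVf ?gt_eqF// mul1e.
  move=> _ [[x y] _ <-]; rewrite /= /mscale/= /pushforward.
  have -> : f @^-1` `]x, y] = `](x - e) / c, (y - e) / c]%classic.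
    apply/seteqP; split=> z; rewrite /f /= !in_itv/= ltr_pdivrMr//;
    by rewrite ler_pdivlMr// ltrBlDr lerBrDr mulrC.
  rewrite !lebesgue_measure_itv/= !lte_fin ltr_pM2r ?invr_gt0// ltrD2r.
  case: ifP => _; rewrite ?mule0//= -!EFinB -EFinM; congr EFin; field.
  by rewrite gt_eqF.
move=> a0 mA; have [a_gt0|] := ltP 0 a; first by rewrite pos// gtr0_norm.
rewrite le_eqVlt (negPf a0)/= => a_lt0.
pose f (x : measurableTypeR R) : measurableTypeR R := - a * x + b.
have mf : measurable_fun setT f.
  by apply: measurable_funD => //; exact: mulrl_measurable.
rewrite ltr0_norm// -(pos _ b)// ?oppr_gt0//.
rewrite -[RHS]lebesgue_measureN; last first.
  by rewrite -[X in measurable X]setTI; exact: mf.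
rewrite /pushforward; congr lebesgue_measure.
by apply/seteqP; split => x /=; rewrite mulrNN.
Qed.

(** * Measure of sets of row vectors, through tuples of coordinates *)

Definition tuple_set (R : realType) n (A : set 'rV[R]_n) :
    set (n.-tuple (measurableTypeR R)) :=
  [set t | A (\row_j tnth t j)].

Definition lebesgue_row (R : realType) n (A : set 'rV[R]_n) : \bar R :=
  lebesgue_tuple (tuple_set A).

Definition borel_row (R : realType) n (A : set 'rV[R]_n) : Prop :=
  measurable (tuple_set A).

Lemma borel_row_affine (R : realType) m n (M : 'M[R]_(m, n)) (v : 'rV[R]_n)
    (A : set 'rV[R]_n) :
  borel_row A -> borel_row [set x | A (x *m M + v)].
Proof.
pose f (t : m.-tuple (measurableTypeR R)) : n.-tuple (measurableTypeR R) :=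
  [tuple \sum_j tnth t j * M j i + v 0 i | i < n].
have mf : measurable_fun setT f.
  apply/measurable_fun_tnthP => i /=.
  rewrite [X in measurable_fun _ X](_ : _ =
      (fun t => \sum_j tnth t j * M j i) \+ cst (v 0 i)); last first.
    by apply/funext => t /=; rewrite tnth_mktuple.
  apply: measurable_funD => //; apply: measurable_sum => j.
  apply: measurable_funM => //; exact: measurable_tnth.
move=> /(mf measurableT); rewrite setTI /borel_row; congr measurable.
apply/seteqP; split=> t; rewrite /tuple_set /=;
  congr A; apply/rowP => i; rewrite !mxE tnth_mktuple; congr (_ + _);
  by apply: eq_bigr => j _; rewrite mxE.
Qed.

Lemma row_cons (R : realType) n (x : R) (t : n.-tuple R) :
  \row_j tnth [tuple of x :: t] j = row_mx x%:M (\row_j tnth t j) :> 'rV_(1 + n).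
Proof.
apply/rowP => j; rewrite !mxE; case: splitP => k jk; rewrite !mxE.
  by rewrite (ord1 k) eqxx mulr1n (tnth_nth 0) /= jk (ord1 k).
by rewrite !(tnth_nth 0) /= jk.
Qed.

Section Cavalieri.
Variables (R : realType) (n : nat) (A B : set 'rV[R]_(1 + n)) (k : R).
Hypotheses (k0 : 0 <= k) (mA : borel_row A) (mB : borel_row B).

Let pair_set (C : set 'rV[R]_(1 + n)) :
    set (measurableTypeR R * n.-tuple (measurableTypeR R)) :=
  [set p | C (row_mx p.1%:M (\row_j tnth p.2 j))].

Let pair_setE C : (fun p : measurableTypeR R * n.-tuple (measurableTypeR R) =>
  [tuple of p.1 :: p.2]) @^-1` tuple_set C = pair_set C.
Proof. by apply/seteqP; split=> p; rewrite /tuple_set /pair_set/= row_cons. Qed.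

Let measurable_pair_set C : borel_row C -> measurable (pair_set C).
Proof.
move=> mC; rewrite -pair_setE -[X in measurable X]setTI.
have mc : measurable_fun setT (fun p : measurableTypeR R *
    n.-tuple (measurableTypeR R) => [the n.+1.-tuple _ of p.1 :: p.2]).
  exact: measurable_cons.
exact: (mc measurableT _ mC).
Qed.

Lemma lebesgue_row_Cavalieri_tail :
  (forall x, lebesgue_row [set s | B (row_mx x%:M s)] =
     (k%:E * lebesgue_row [set s | A (row_mx x%:M s)])%E) ->
  lebesgue_row B = (k%:E * lebesgue_row A)%E.
Proof.
have [m mE] := lebesgue_tuple_sigma_finite R n.
move=> H; rewrite /lebesgue_row/= mE /pushforward !pair_setE.
rewrite /product_measure1 -ge0_integralZl//.
- apply: eq_integral => x _ /=.
  have := H x; rewrite /lebesgue_row mE.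
  have xE C : xsection (pair_set C) x = tuple_set [set s | C (row_mx x%:M s)].
    by apply/seteqP; split=> s; rewrite /xsection /= in_setE.
  by rewrite !xE.
- exact: measurable_fun_xsection (measurable_pair_set mA).
Qed.

(** The slices are now lines parallel to the first axis. Both orders of integration give the same
    product measure, since they agree on rectangles. *)
Lemma lebesgue_row_Cavalieri_head :
  (forall s : 'rV_n, lebesgue_measure
       [set x : measurableTypeR R | B (row_mx x%:M s)] =
     (k%:E * lebesgue_measure
       [set x : measurableTypeR R | A (row_mx x%:M s)])%E) ->
  lebesgue_row B = (k%:E * lebesgue_row A)%E.
Proof.
have [m mE] := lebesgue_tuple_sigma_finite R n.
move=> H; rewrite /lebesgue_row/= mE /pushforward !pair_setE.
have sw C : borel_row C ->
    (lebesgue_measure \x m)%E (pair_set C) =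
    (lebesgue_measure \x^ m)%E (pair_set C).
  move=> mC.
  apply: product_measure_unique (measurable_pair_set mC) => X Y mX mY /=.
  by rewrite product_measure2E.
rewrite !sw// /product_measure2 -ge0_integralZl//.
- apply: eq_integral => t _ /=.
  have := H (\row_j tnth t j).
  have yE C : ysection (pair_set C) t =
      [set x : measurableTypeR R | C (row_mx x%:M (\row_j tnth t j))].
    by apply/seteqP; split=> x; rewrite /ysection /= in_setE.
  by rewrite !yE.
- exact: measurable_fun_ysection (measurable_pair_set mA).
Qed.

End Cavalieri.

(** Phrased with preimages, which stay Borel because affine maps are measurable; hence the inverse
    of the determinant. *)
Definition affine_scaling (R : realType) n (M : 'M[R]_n) (v : 'rV[R]_n) : Prop :=
  forall A, borel_row A ->
    lebesgue_row [set x | A (x *m M + v)] =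
      (`|\det M|^-1%:E * lebesgue_row A)%E.

Lemma affine_scaling_comp (R : realType) n (M N : 'M[R]_n) (v w : 'rV[R]_n) :
  affine_scaling M v -> affine_scaling N w ->
  affine_scaling (M *m N) (v *m N + w).
Proof.
move=> hM hN A mA.
rewrite (_ : [set x | _] =
  [set x | [set y | A (y *m N + w)] (x *m M + v)]); last first.
  by apply/seteqP; split=> x /=; rewrite mulmxDl mulmxA addrA.
rewrite hM; last exact: borel_row_affine.
by rewrite hN// muleA -EFinM det_mulmx normrM invfM mulrC.
Qed.

(** The map preserves the first coordinate [x] and acts on that slice by [N] with translation
    [x *: c + w], which varies with [x]. *)
Lemma affine_scaling_tail (R : realType) n (N : 'M[R]_n) (c w : 'rV[R]_n) :
  (forall v, affine_scaling N v) ->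
  affine_scaling (block_mx 1%:M c 0 N : 'M[R]_(1 + n))
    (row_mx 0 w : 'rV[R]_(1 + n)).
Proof.
move=> hN A mA; rewrite (det_ublock (1%:M : 'M[R]_1)) det1 mul1r.
apply: (lebesgue_row_Cavalieri_tail (A := A) _ mA); first by rewrite invr_ge0.
move=> x.
rewrite -(hN (x *: c + w)); last first.
  have := borel_row_affine (row_mx 0 1%:M) (row_mx x%:M 0) mA.
  congr borel_row; apply/seteqP; split=> s /=;
  by rewrite mul_mx_row mulmx0 mulmx1 add_row_mx add0r addr0.
congr lebesgue_row; apply/seteqP; split=> s /=;
  by rewrite mul_row_block mulmx1 mulmx0 addr0 add_row_mx addr0 mul_scalar_mx
    addrCA addrA.
Qed.

(** On the line with fixed tail [s] the map is one-dimensional, with slope [a] and translation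
    [s *m b + w]. *)
Lemma affine_scaling_head (R : realType) n (a : R) (b : 'cV[R]_n) (w : 'M[R]_1) :
  a != 0 ->
  affine_scaling (block_mx a%:M 0 b 1%:M : 'M[R]_(1 + n))
    (row_mx w 0 : 'rV[R]_(1 + n)).
Proof.
move=> a0 A mA; rewrite (det_lblock (a%:M : 'M[R]_1)) det1 mulr1 det_scalar1.
have mB := borel_row_affine
  (block_mx a%:M 0 b 1%:M : 'M[R]_(1 + n)) (row_mx w 0 : 'rV[R]_(1 + n)) mA.
apply: (lebesgue_row_Cavalieri_head (A := A) _ mA mB); first by rewrite invr_ge0.
move=> s.
have mAs : measurable [set x : measurableTypeR R | A (row_mx x%:M s)].
  pose t : n.-tuple (measurableTypeR R) := [tuple s 0 i | i < n].
  have mt : measurable_fun setT (fun x : measurableTypeR R =>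
      [the n.+1.-tuple (measurableTypeR R) of x :: t]).
    exact: measurable_cons.
  have := mt measurableT _ mA; rewrite setTI; congr measurable.
  have -> : s = \row_i tnth t i by apply/rowP => i; rewrite mxE tnth_mktuple.
  by apply/seteqP; split=> x; rewrite /tuple_set /= row_cons.
rewrite -(lebesgue_measure_affine ((s *m b + w) 0 0))//.
congr lebesgue_measure; apply/seteqP; split=> x /=; congr A;
  rewrite mul_row_block mulmx1 mulmx0 add0r add_row_mx addr0 mul_scalar_mx;
  by congr row_mx; apply/matrixP => i j; rewrite !ord1 !mxE !mulr1n mulrC addrA.
Qed.

Theorem lebesgue_row_affine (R : realType) n (M : 'M[R]_n) (v : 'rV[R]_n) :
  M \in unitmx -> affine_scaling M v.
Proof.
elim: n M v => [|n IH] M v uM.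
  move=> A _; rewrite det_mx00 normr1 invr1 mul1e; congr lebesgue_row.
  by apply/seteqP; split=> x /=; rewrite (thinmx0 x) thinmx0.
have pivot (M' : 'M[R]_(1 + n)) (v' : 'rV[R]_(1 + n)) : M' \in unitmx ->
    M' 0 0 != 0 -> affine_scaling M' v'.
  move=> uM' a0; set a := M' 0 0 in a0.
  (* Block LU factorization: [N] is the Schur complement of the pivot [a]. *)
  pose c := a^-1 *: ursubmx M'; pose b := dlsubmx M'.
  pose N := drsubmx M' - b *m c.
  have M'E : M' = block_mx a%:M 0 b 1%:M *m block_mx 1%:M c 0 N.
    rewrite mulmx_block !mulmx1 !mulmx0 !mul0mx !addr0 mul1mx.
    rewrite mul_scalar_mx scalerA mulfV// scale1r addrC subrK.
    rewrite -[LHS](submxK (m1 := 1) (n1 := 1)); congr block_mx.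
    by rewrite [LHS]mx11_scalar !mxE; congr (M' _ _)%:M; exact: val_inj.
  have uN : N \in unitmx.
    move: uM'; rewrite M'E !unitmxE det_mulmx (det_ublock (1%:M : 'M[R]_1)).
    by rewrite det1 mul1r unitrM => /andP[].
  pose v0 := lsubmx v'.
  have -> : v' = row_mx v0 0 *m block_mx 1%:M c 0 N +
      row_mx 0 (rsubmx v' - v0 *m c).
    rewrite mul_row_block !mulmx1 !mul0mx !addr0 add_row_mx addr0 addrC subrK.
    by rewrite hsubmxK.
  rewrite M'E; apply: affine_scaling_comp.
    exact: affine_scaling_head.
  by apply: affine_scaling_tail => w; exact: IH.
have [a0|a0] := eqVneq (M 0 0) 0; last exact: pivot.
(* Otherwise the first column would vanish and [M] would be singular. *)
have [j bj] : exists j : 'I_n, (dlsubmx (M : 'M[R]_(1 + n))) j 0 != 0.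
  apply/existsP; apply: contraLR uM => /existsPn b0.
  rewrite unitmxE; suff -> : \det M = 0 by rewrite unitr0.
  rewrite -(submxK (M : 'M[R]_(1+n, 1+n))).
  have -> : dlsubmx (M : 'M[R]_(1+n)) = 0.
    apply/matrixP => i k; rewrite (ord1 k) [RHS]mxE; apply/eqP.
    by have := b0 i; rewrite negbK.
  rewrite (det_ublock (ulsubmx (M : 'M[R]_(1+n)))).
  rewrite (_ : ulsubmx _ = 0) ?det0 ?mul0r //.
  apply/matrixP => i k; rewrite !ord1 !mxE -[RHS]a0.
  by congr (M _ _); exact: val_inj.
(* Left multiplication by [E e] adds row [j] of the lower block to the top row, making the pivot
   nonzero; the shear [E (- e)] undoes this. *)
pose e : 'rV[R]_n := delta_mx 0 j.
pose E (x : 'rV[R]_n) : 'M[R]_(1 + n) := block_mx 1%:M x 0 1%:M.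
have dE x : \det (E x) = 1.
  by rewrite /E (det_ublock (1%:M : 'M[R]_1)) !det1 mulr1.
have ME : M = E (- e) *m (E e *m M).
  rewrite mulmxA /E mulmx_block !mulmx1 !mulmx0 !mul0mx !addr0 !mul1mx subrr.
  by rewrite !add0r -scalar_mx_block mul1mx.
rewrite ME -(add0r v) -(mul0mx _ (E e *m M)).
have -> : 0 = row_mx 0 0 :> 'rV[R]_(1 + n) by rewrite row_mx0.
apply: affine_scaling_comp.
  by apply: affine_scaling_tail => w; apply: IH; exact: unitmx1.
apply: pivot; first by rewrite unitmx_mul uM unitmxE dE unitr1.
pose M1 : 'M[R]_(1 + n, 1 + n) := M.
have -> : (E e *m M) 0 0 = (E e *m M1) (lshift n 0) (lshift n 0).
  by congr (_ _ _); exact: val_inj.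
rewrite -(submxK M1) /E mulmx_block block_mxEul mul1mx -rowE !mxE.
rewrite (_ : M1 _ _ = 0) ?add0r; last first.
  by rewrite -a0; congr (M _ _); exact: val_inj.
by move: bj; rewrite !mxE.
Qed.

(** * Signed volume *)

Definition corner (R : realType) d : set 'rV[R]_d :=
  [set x | (forall i, 0 <= x 0 i) /\ \sum_i x 0 i <= 1].
Arguments corner : clear implicits.

Lemma borel_row_corner (R : realType) d : borel_row (corner R d).
Proof.
rewrite /borel_row (_ : tuple_set _ =
  (\bigcap_(i in [set: 'I_d]) [set t | 0 <= tnth t i]) `&`
    [set t | \sum_i tnth t i <= 1]); last first.
  apply/seteqP; split=> t; rewrite /tuple_set /corner /=.
    move=> [t0 t1]; split=> [i _ /=|]; first by have := t0 i; rewrite mxE.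
    by move: t1; under eq_bigr do rewrite mxE.
  move=> [t0 t1]; split=> [i|]; first by rewrite mxE; exact: t0.
  by under eq_bigr do rewrite mxE.
have mt (i : 'I_d) : measurable_fun setT
    (fun t : d.-tuple (measurableTypeR R) => tnth t i : R).
  exact: measurable_tnth.
apply: measurableI.
  apply: fin_bigcap_measurable => // i _.
  by rewrite -[X in measurable X]setTI; exact: measurable_fun_le.
rewrite -[X in measurable X]setTI; apply: measurable_fun_le => //.
exact: measurable_sum.
Qed.

Lemma edge_mx_comb (R : realType) d (V : 'M[R]_(d.+1, d)) (w : 'rV[R]_d) :
  w *m edge_mx V =
    \sum_i w 0 i *: row (lift ord0 i) V - (\sum_i w 0 i) *: row ord0 V.
Proof.
rewrite mulmx_sum_row scaler_suml -sumrB; apply: eq_bigr => i _.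
by rewrite rowK scalerBr.
Qed.

(** The coordinates of [x - row ord0 V] in the edge basis are the barycentric weights of the other
    vertices; vertex 0 takes the remaining weight. *)
Lemma conv_corner (R : realType) d (V : 'M[R]_(d.+1, d)) :
  edge_mx V \in unitmx ->
  Defs.conv V = [set x | corner R d
    (x *m invmx (edge_mx V) + - row ord0 V *m invmx (edge_mx V))].
Proof.
move=> uE; apply/seteqP; split=> x /=.
  move=> [w [w0 w1 xE]]; pose u := \row_i w (lift ord0 i).
  have sw : \sum_i u 0 i = 1 - w ord0.
    rewrite -w1 big_ord_recl addrC addrA addNr add0r.
    by under eq_bigr do rewrite mxE.
  have -> : x *m invmx (edge_mx V) + - row ord0 V *m invmx (edge_mx V) = u.
    rewrite -mulmxDl; apply: (canLR (mulmxK uE)).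
    rewrite edge_mx_comb sw xE big_ord_recl scalerBl scale1r opprB addrCA addrA.
    by congr (_ + _ + _); apply: eq_bigr => i _; rewrite mxE.
  by rewrite /corner/= sw; split=> [i|]; rewrite ?mxE// lerBlDr lerDl.
rewrite -mulmxDl; set u := _ *m _ => -[u0 u1].
exists (fun i => if unlift ord0 i is Some j then u 0 j else 1 - \sum_i u 0 i).
rewrite !big_ord_recl unlift_none; split.
- move=> i; case: unliftP => [j|] _; first exact: u0.
  by rewrite subr_ge0.
- rewrite -[RHS](subrK (\sum_i u 0 i)); congr (_ + _).
  by apply: eq_bigr => i _; rewrite liftK.
- under [X in _ + X]eq_bigr do rewrite liftK.
  rewrite -[LHS](subrK (row ord0 V)) -[X in X + _](mulmxKV uE) -/u edge_mx_comb.
  by rewrite scalerBl scale1r [RHS]addrC addrAC -addrA.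
Qed.

(** The absolute determinant from the scaling and the sign in [orientation] combine to the
    determinant itself. *)
Lemma signed_volumeE (R : realType) d (D : simplex R d) :
  signed_volume D = fine (lebesgue_row (corner R d)) * \det (edge_mx D).
Proof.
have uE : edge_mx D \in unitmx.
  by rewrite -row_free_unit; exact: Defs.nondegenerate.
have d0 : \det (edge_mx D) != 0 by move: uE; rewrite unitmxE unitfE.
rewrite /signed_volume /orientation /volume.
rewrite -/(tuple_set (Defs.conv D)) -/(lebesgue_row (Defs.conv D)) conv_corner//.
rewrite lebesgue_row_affine ?unitmx_inv//; last exact: borel_row_corner.
rewrite det_inv normfV invrK.
(* For infinite [x] both sides are 0, the default value of [fine]. *)
have fineZ r (x : \bar R) : 0 < r -> fine (r%:E * x)%E = r * fine x.
  by move=> r0; case: x => [x| |] //=;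
    rewrite ?gt0_muley ?gt0_muleNy ?mulr0 ?lte_fin.
by rewrite fineZ ?normr_gt0// mulrA -numEsg mulrC.
Qed.

(** * Alternating face functions *)

Lemma det_row_mx_col (R : comNzRingType) d (u : 'cV[R]_d.+1) (V : 'M[R]_(d.+1, d)) :
  \det (row_mx u V : 'M[R]_(1 + d)) =
  \sum_(i < d.+1) (-1) ^+ i * (u i 0 * \det (row' i V)).
Proof.
rewrite (expand_det_col _ (lshift d (0 : 'I_1))); apply: eq_bigr => i _.
rewrite row_mxEl /cofactor /= addn0 mulrCA; congr (_ * (_ * \det _)).
apply/matrixP => j k; rewrite !mxE.
case: splitP => l /= kl; first by move: (ltn_ord l); rewrite -kl.
by congr (V _ _); apply/val_inj; move: kl; rewrite /= /bump /= add1n => -[].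
Qed.

(** Border [V] with a column of ones: subtracting the first row from the others gives the left side,
    Laplace expansion along that column the right side. *)
Lemma det_edge_mx (R : realType) d (V : 'M[R]_(d.+1, d)) :
  \det (edge_mx V) = \sum_(i < d.+1) (-1) ^+ i * \det (row' i V).
Proof.
pose A : 'M[R]_(1 + d) := row_mx (const_mx 1) V.
transitivity (\det A); last first.
  by rewrite det_row_mx_col; apply: eq_bigr => i _; rewrite mxE mul1r.
pose v0 : 'rV[R]_d := usubmx (V : 'M[R]_(1 + d, d)).
pose V1 : 'M[R]_d := dsubmx (V : 'M[R]_(1 + d, d)).
have -> : A = block_mx 1%:M 0 (const_mx 1) 1%:M *m
    block_mx 1%:M v0 0 (edge_mx V).
  rewrite mulmx_block !mulmx1 !mul1mx !mul0mx !addr0.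
  have -> : const_mx 1 *m v0 + edge_mx V = V1.
    apply/matrixP => i j; rewrite !mxE big_ord1 !mxE mul1r addrC.
    rewrite (_ : lshift d 0 = ord0) ?subrK; last exact: val_inj.
    by congr (V _ _); exact: val_inj.
  rewrite block_mxEh vsubmxK (_ : 1%:M = const_mx 1) ?col_mx_const//.
  by apply/matrixP => i j; rewrite !ord1 !mxE.
rewrite det_mulmx (det_lblock (1%:M : 'M[R]_1)) (det_ublock (1%:M : 'M[R]_1)).
by rewrite !det1 !mul1r.
Qed.

(** Pair the zero boundary with [phi]. Each face meets all its [d]![orderings, and the two signs
    cancel, so the pairing is]d[!] times the desired sum. *)
Lemma cycle_alternating_sum (R : realType) d (C : chain R d)
    (phi : 'M[R]_d -> R) :
  is_cycle C ->
  (forall (s : 'S_d) f, phi (row_perm s f) = (-1) ^+ s * phi f) ->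
  \sum_(D <- C) \sum_(i < d.+1) (-1) ^+ i * phi (row' i D) = 0.
Proof.
move=> hC hphi; pose Vs := [seq vertices D | D <- C].
(* A finite list, without repetitions, of all orderings of all faces. *)
pose G := undup (flatten [seq [seq row_perm p.2 (row' p.1 V) |
  p : 'I_d.+1 * 'S_d] | V <- Vs]).
have inG V i s : V \in Vs -> row_perm s (row' i V) \in G.
  move=> VC; rewrite mem_undup; apply/flatten_mapP; exists V => //.
  by apply/mapP; exists (i, s); rewrite ?mem_enum.
have : \sum_(g <- G) (boundary C g)%:~R * phi g = 0.
  by apply: big1 => g _; rewrite hC mul0r.
rewrite -(big_map (@vertices R d) xpredT
  (fun V => \sum_(i < d.+1) (-1) ^+ i * phi (row' i V))) -/Vs.
rewrite (eq_bigr (fun g => \sum_(V <- Vs) \sum_(i < d.+1)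
    (-1) ^+ i * ((face_coef (row' i V) g)%:~R * phi g))); last first.
  move=> g _; rewrite /boundary rmorph_sum mulr_suml big_map.
  apply: eq_bigr => D _.
  rewrite rmorph_sum mulr_suml; apply: eq_bigr => i _.
  by rewrite rmorphM rmorphXn rmorphN1 mulrA.
rewrite exchange_big /= => H.
suff : \sum_(V <- Vs) (\sum_(i < d.+1) (-1) ^+ i * phi (row' i V)) *+ d`! = 0.
  by rewrite sumrMnl => /eqP; rewrite mulrn_eq0 -leqn0 leqNgt fact_gt0/= => /eqP.
rewrite -[RHS]H; rewrite !big_seq; apply: eq_bigr => V VC.
rewrite -sumrMnl exchange_big /=; apply: eq_bigr => i _.
rewrite -mulr_sumr -mulrnAr; congr (_ * _).
transitivity (\sum_(s : 'S_d) (-1) ^+ s * phi (row_perm s (row' i V))).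
  under eq_bigr do rewrite hphi mulrA -expr2 sqrr_sign mul1r.
  by rewrite sumr_const card_Sn.
rewrite (eq_bigr (fun g => \sum_(s : 'S_d)
   if row_perm s (row' i V) == g then (-1) ^+ s * phi g else 0)); last first.
  move=> g _; rewrite -big_mkcond /face_coef rmorph_sum mulr_suml.
  by apply: eq_bigr => s _; rewrite rmorphXn rmorphN1.
rewrite exchange_big; apply: eq_bigr => s _.
rewrite (bigD1_seq (row_perm s (row' i V))) ?inG ?undup_uniq//= eqxx.
by rewrite big1 ?addr0// => g /negPf; rewrite eq_sym => ->.
Qed.

Lemma det_row_perm (R : comNzRingType) d (s : 'S_d) (A : 'M[R]_d) :
  \det (row_perm s A) = (-1) ^+ s * \det A.
Proof. by rewrite row_permE det_mulmx det_perm. Qed.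

(** Up to a constant, signed volume times the [k]-th centroid coordinate of the cone from the origin
    over [f]. *)
Definition moment (R : comNzRingType) d (k : 'I_d) (f : 'M[R]_d) : R :=
  \det f * \sum_j f j k.

Lemma moment_row_perm (R : comNzRingType) d (k : 'I_d) (s : 'S_d) (f : 'M[R]_d) :
  moment k (row_perm s f) = (-1) ^+ s * moment k f.
Proof.
rewrite /moment det_row_perm -mulrA; congr (_ * (_ * _)).
rewrite [RHS](reindex_inj (@perm_inj _ s)) /=.
by apply: eq_bigr => j _; exact: mxE.
Qed.

(** A determinant with column [k] repeated vanishes; subtracting its expansion removes the deleted
    vertex from the coordinate sum in each term. *)
Lemma det_edge_mx_sum (R : realType) d (V : 'M[R]_(d.+1, d)) (k : 'I_d) :
  \det (edge_mx V) * \sum_i V i k =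
  \sum_(i < d.+1) (-1) ^+ i * moment k (row' i V).
Proof.
have dV0 : \det (row_mx (col k V) V : 'M[R]_(1 + d)) = 0.
  rewrite -det_tr tr_row_mx.
  apply: (@determinant_alternate _ _ _ (lshift d 0) (rshift 1 k)).
    by rewrite -val_eqE.
  by move=> j; rewrite col_mxEu col_mxEd !mxE.
rewrite -[LHS]subr0 -[X in _ - X = _]dV0 det_row_mx_col det_edge_mx mulr_suml.
rewrite -sumrB.
apply: eq_bigr => i _; rewrite /moment -mulrA -mulrBr; congr (_ * _).
rewrite mxE [V i k * _]mulrC -mulrBr; congr (_ * _).
rewrite (bigD1_ord i) //= addrAC subrr add0r.
by apply: eq_bigr => j _; rewrite mxE.
Qed.

(** * Circumcenters and Cramer's rule *)

Definition sq_row (R : comNzRingType) m d (V : 'M[R]_(m, d)) (i : 'I_m) : R :=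
  \sum_j V i j ^+ 2.

Definition set_col T m d (k : 'I_d) (u : 'I_m -> T) (V : 'M[T]_(m, d)) :
    'M[T]_(m, d) :=
  \matrix_(i, j) if j == k then u i else V i j.

Lemma det_set_col (R : comNzRingType) d (k : 'I_d) (u : 'cV[R]_d) (A : 'M[R]_d) :
  \det (set_col k (u^~ 0) A) = (\adj A *m u) k 0.
Proof.
rewrite (expand_det_col _ k) mxE; apply: eq_bigr => i _.
rewrite !mxE eqxx mulrC; congr (_ * \det _ * _).
by apply/matrixP => a b; rewrite !mxE eq_sym (negPf (neq_lift _ _)).
Qed.

Definition sq_moment (R : comNzRingType) d (k : 'I_d) (f : 'M[R]_d) : R :=
  \det (set_col k (sq_row f) f).

Lemma sq_moment_row_perm (R : comNzRingType) d (k : 'I_d) (s : 'S_d) (f : 'M[R]_d) :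
  sq_moment k (row_perm s f) = (-1) ^+ s * sq_moment k f.
Proof.
rewrite /sq_moment -det_row_perm; congr (\det _); apply/matrixP => i j.
by rewrite !mxE; case: ifP => // _; apply: eq_bigr => l _; rewrite mxE.
Qed.

Definition sq_diff (R : realType) d (V : 'M[R]_(d.+1, d)) : 'cV[R]_d :=
  \col_i (sq_row V (lift ord0 i) - sq_row V ord0).

(** Subtracting the squared distance to vertex 0 from that to another vertex cancels the squared
    norm of [o] and leaves a linear equation. *)
Lemma is_circumcenterP (R : realType) d (D : simplex R d) (o : 'rV[R]_d) :
  is_circumcenter D o <-> edge_mx D *m (2 *: o^T) = sq_diff D.
Proof.
pose S i := \sum_j (o 0 j - row i D 0 j) ^+ 2.
have S0 i : 0 <= S i by apply: sumr_ge0 => j _; exact: sqr_ge0.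
have SE i : S (lift ord0 i) - S ord0 =
    sq_diff D i 0 - (edge_mx D *m (2 *: o^T)) i 0.
  by rewrite !mxE /S /sq_row -!sumrB; apply: eq_bigr => j _; rewrite !mxE; ring.
split=> [[r hr]|h].
  have Sr i : S i = r ^+ 2 by rewrite -(hr i) /euclidean_dist sqr_sqrtr ?S0.
  apply/esym/matrixP => i j; rewrite ord1; apply/eqP; rewrite -subr_eq0 -SE.
  by rewrite !Sr subrr.
exists (Num.sqrt (S ord0)) => i; rewrite /euclidean_dist -/(S i); congr Num.sqrt.
have [j ->|->//] := unliftP ord0 i.
by apply/eqP; rewrite -subr_eq0 SE h subrr.
Qed.

Lemma circumcenterP (R : realType) d (D : simplex R d) :
  edge_mx D *m (2 *: (circumcenter D)^T) = sq_diff D.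
Proof.
apply/is_circumcenterP; rewrite /circumcenter; apply: (xgetPex 0).
(* The linear system is solvable, so [xget] returns a genuine circumcenter and not its default 0. *)
exists (2^-1 *: (invmx (edge_mx D) *m sq_diff D)^T); apply/is_circumcenterP.
rewrite [X in 2 *: X](_ : _ = 2^-1 *: (invmx (edge_mx D) *m sq_diff D));
  last by rewrite linearZ /= trmxK.
rewrite scalerA divff ?pnatr_eq0// scale1r mulKVmx//.
by rewrite -row_free_unit; exact: Defs.nondegenerate.
Qed.

(** Replacing column [k] by squared norms commutes with forming edges and with deleting a vertex, so
    the Cramer numerator is itself the determinant of an edge matrix and expands over faces. *)
Lemma det_edge_mx_circumcenter (R : realType) d (D : simplex R d) (k : 'I_d) :
  2 * (\det (edge_mx D) * circumcenter D 0 k) =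
  \sum_(i < d.+1) (-1) ^+ i * sq_moment k (row' i D).
Proof.
pose W := set_col k (sq_row D) D.
transitivity (\det (edge_mx W)).
  have -> : edge_mx W = set_col k ((sq_diff D)^~ 0) (edge_mx D).
    by apply/matrixP => i j; rewrite !mxE; case: ifP.
  rewrite det_set_col -circumcenterP mulmxA mul_adj_mx mul_scalar_mx !mxE.
  by ring.
rewrite det_edge_mx; apply: eq_bigr => i _; congr (_ * \det _).
apply/matrixP => a b; rewrite !mxE; case: ifP => // _.
by apply: eq_bigr => j _; rewrite mxE.
Qed.

Theorem corollary1 (R : realType) (d : nat) (C : chain R d) (hC : is_cycle C) :
  \sum_(D <- C) signed_volume D *: (centroid D - circumcenter D) = 0.
Proof.
apply/rowP => k; rewrite summxE mxE.
have m0 := cycle_alternating_sum hC (moment_row_perm k).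
have q0 := cycle_alternating_sum hC (sq_moment_row_perm k).
set c := fine (lebesgue_row (corner R d)).
(* The divisor [d.+1] comes from averaging the vertices, the divisor 2 from the circumcenter
   equations. *)
transitivity (\sum_(D <- C) (c / d.+1%:R * (\det (edge_mx D) * \sum_i D i k) -
   c / 2 * (2 * (\det (edge_mx D) * circumcenter D 0 k)))).
  apply: eq_bigr => D _; rewrite signed_volumeE -/c !mxE summxE.
  under eq_bigr do rewrite mxE.
  by field; rewrite nat1r pnatr_eq0.
under eq_bigr do rewrite det_edge_mx_sum det_edge_mx_circumcenter.
by rewrite sumrB -!mulr_sumr m0 q0 !mulr0 subr0.
Qed.
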